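(* For every $\xi\in\mathfrak{g}_2\setminus\{0\}$, the vector field $J(X_\xi)$ on $\mathbb{S}^6$ is not a fundamental vector field of the $G_2$-action on $\mathbb{S}^6$, i.e. there is no $\eta\in\mathfrak{g}_2$ with $J(X_\xi)=X_\eta$.
   Context: The octonions $\mathbb{O}$ are the real algebra with vector space basis $e_0,e_1,\dots,e_7$, unit $e_0=1$, and products $e_ie_j=-\delta_{ij}+\sum_{k=1}^7\epsilon_{ijk}e_k$ for $i,j\in\{1,\dots,7\}$, where $\epsilon_{ijk}$ is completely antisymmetric, equal to $1$ for $ijk=123,145,167,246,275,374,365$, and $0$ whenever $(i,j,k)$ is not a permutation of one of these triples. The imaginary octonions (span of $e_1,\dots,e_7$) are identified with $\mathbb{R}^7$. The cross product on $\mathbb{R}^7$ is $u\times v:=\frac12(u\cdot v-v\cdot u)$. On the unit sphere $\mathbb{S}^6\subset\mathbb{R}^7$ the almost complex structure $J$ is $J_p(u):=p\times u$ for $p\in\mathbb{S}^6$, $u\in T_p\mathbb{S}^6=p^\perp$. $G_2\subset GL(7,\mathbb{R})$ is the image of the group of $\mathbb{R}$-algebra automorphisms of $\mathbb{O}$ under restriction to the imaginary octonions $\mathbb{R}^7$; it is a closed subgroup of $SO(7,\mathbb{R})$ and acts on $\mathbb{S}^6$. Its Lie algebra is $\mathfrak{g}_2$, and $X_\xi$ denotes the fundamental vector field on $\mathbb{S}^6$ of $\xi\in\mathfrak{g}_2$, $X_\xi(p)=\frac{d}{dt}\big|_{t=0}e^{t\xi}\cdot p$. *)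

(* Defs.v *)
From HB Require Import structures.
From mathcomp Require Import all_boot all_order all_algebra.
From mathcomp Require Import all_classical all_reals all_analysis.
Set Implicit Arguments.
Unset Strict Implicit.
Unset Printing Implicit Defensive.
Import Order.TTheory GRing.Theory Num.Theory.
Import numFieldNormedType.Exports.
Local Open Scope classical_set_scope.
Local Open Scope ring_scope.

(** Octonions are coordinate columns [x : 'cV[R]_8] in the basis e_0, ..., e_7;
    R^7 is ['cV[R]_7], whose coordinate number [k] (counted from 0) is the
    coefficient of e_(k+1). *)

Definition fano_triples : seq (nat * nat * nat) :=
  [:: (1, 2, 3); (1, 4, 5); (1, 6, 7); (2, 4, 6); (2, 7, 5); (3, 7, 4);
      (3, 6, 5)]%N.

Definition octonion_eps (R : pzRingType) (i j k : nat) : R :=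
  if has (mem fano_triples) [:: (i, j, k); (j, k, i); (k, i, j)] then 1
  else if has (mem fano_triples) [:: (j, i, k); (i, k, j); (k, j, i)] then -1
  else 0.

Section Octonions.
Variable R : realType.

Definition octonion_basis (i : 'I_8) : 'cV[R]_8 := delta_mx i 0.

Definition octonion_basis_mul (i j : 'I_8) : 'cV[R]_8 :=
  if i == 0 then octonion_basis j
  else if j == 0 then octonion_basis i
  else - (i == j)%:R *: octonion_basis 0
       + \sum_(k < 8 | k != 0) octonion_eps R i j k *: octonion_basis k.

Definition octonion_mul (x y : 'cV[R]_8) : 'cV[R]_8 :=
  \sum_i \sum_j (x i 0 * y j 0) *: octonion_basis_mul i j.

Definition imaginary_octonion (u : 'cV[R]_7) : 'cV[R]_8 :=
  col_mx (0 : 'cV[R]_1) u.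

Definition imaginary_part (x : 'cV[R]_8) : 'cV[R]_7 :=
  dsubmx (x : 'cV[R]_(1 + 7)).

(** The projection [imaginary_part] only changes the type: see
    [imaginary_octonion_cross]. *)
Definition cross (u v : 'cV[R]_7) : 'cV[R]_7 :=
  let x := imaginary_octonion u in let y := imaginary_octonion v in
  imaginary_part (2^-1 *: (octonion_mul x y - octonion_mul y x)).

Lemma octonion_basis_mul0C (i j : 'I_8) :
  octonion_basis_mul i j 0 0 = octonion_basis_mul j i 0 0.
Proof.
rewrite /octonion_basis_mul; case: (eqVneq i 0) => [->|i0].
  by case: (eqVneq j 0) => [->|].
case: (eqVneq j 0) => // j0.
have S0 a b : (\sum_(k < 8 | k != 0)
    octonion_eps R a b k *: octonion_basis k) 0 0 = 0.
  rewrite summxE big1 // => k k0; rewrite !mxE /= eq_sym (negbTE k0).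
  by rewrite mulr0.
by rewrite !mxE !S0 eq_sym.
Qed.

Lemma imaginary_octonion_cross (u v : 'cV[R]_7) :
  imaginary_octonion (cross u v) =
  2^-1 *: (octonion_mul (imaginary_octonion u) (imaginary_octonion v)
           - octonion_mul (imaginary_octonion v) (imaginary_octonion u)).
Proof.
rewrite /cross /=; set x := imaginary_octonion u; set y := imaginary_octonion v.
set w : 'cV[R]_(1 + 7) := 2^-1 *: _.
suff w0 : usubmx w = 0 by rewrite /imaginary_octonion -w0; exact: (@vsubmxK _ 1 7 1 w).
apply/colP => i; rewrite ord1 [LHS]mxE [RHS]mxE.
have -> : lshift 7 (0 : 'I_1) = 0 :> 'I_8 by exact: val_inj.
suff xy : octonion_mul x y 0 0 = octonion_mul y x 0 0.
  by rewrite /w [LHS]mxE [X in _ * X]mxE [X in _ + X]mxE xy subrr mulr0.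
rewrite /octonion_mul !summxE.
under eq_bigr do rewrite summxE; under [RHS]eq_bigr do rewrite summxE.
rewrite exchange_big /=; apply: eq_bigr => i0 _; apply: eq_bigr => j _.
by rewrite [LHS]mxE [RHS]mxE octonion_basis_mul0C [x _ _ * _]mulrC.
Qed.

Definition octonion_automorphism (f : {linear 'cV[R]_8 -> 'cV[R]_8}) : Prop :=
  bijective f /\ forall x y, f (octonion_mul x y) = octonion_mul (f x) (f y).

Definition G2 : set 'M[R]_7 :=
  [set g | exists2 f : {linear 'cV[R]_8 -> 'cV[R]_8},
     octonion_automorphism f &
     forall u, f (imaginary_octonion u) = imaginary_octonion (g *m u)].

Definition mx_exp n (A : 'M[R]_n.+1) : 'M[R]_n.+1 :=
  limn (series (fun k => k`!%:R^-1 *: A ^+ k)).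

(** The Lie algebra of the closed linear group [G2]. *)
Definition g2 : set 'M[R]_7 := [set xi | forall t : R, G2 (mx_exp (t *: xi))].

(** The unit sphere for the Euclidean norm; the library norm on matrices is
    the sup norm. *)
Definition S6 : set 'cV[R]_7 := [set p | \sum_i p i 0 ^+ 2 = 1].

(** Vector fields on the sphere are represented by functions on R^7, of which
    only the values on [S6] are meaningful. *)
Definition fundamental_field (xi : 'M[R]_7) (p : 'cV[R]_7) : 'cV[R]_7 :=
  derive1 (fun t : R => mx_exp (t *: xi) *m p) 0.

Definition J (p u : 'cV[R]_7) : 'cV[R]_7 := cross p u.

Definition J_field (X : 'cV[R]_7 -> 'cV[R]_7) (p : 'cV[R]_7) : 'cV[R]_7 :=
  J p (X p).

Definition is_fundamental_field (X : 'cV[R]_7 -> 'cV[R]_7) : Prop :=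
  exists2 eta, g2 eta & forall p, S6 p -> X p = fundamental_field eta p.

End Octonions.

(* Main.v *)
Require Import Defs.
From mathcomp Require Import all_boot all_order all_algebra.
From mathcomp Require Import all_classical all_reals all_analysis.
Local Open Scope ring_scope.
Set Implicit Arguments.
Unset Strict Implicit.
Import Order.TTheory GRing.Theory Num.Theory.
Import numFieldNormedType.Exports.

(** Fundamental fields are linear in the point: [X_xi p = xi *m p]
    ([fundamental_fieldE]), hence odd, while [J X_xi p = p x (xi p)] is quadratic
    in [p], hence even.  As the sphere is symmetric, an equality [J X_xi = X_eta]
    forces both sides to vanish: [p x (xi p) = 0] for every [p] on the sphere.

    Only the seven basis vectors [p = e_i] are then used.  The map [v |-> e_i x v]
    has kernel [R e_i], because two points of the Fano plane lie on exactly one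
    line ([fano_line], [cross_basis_eq0]); so each [e_i] is an eigenvector of [xi],
    that is, [xi] is diagonal, with diagonal [d].

    Finally [g2] contains no nonzero diagonal matrix ([g2_diag_eq0]): [exp xi] is
    diagonal with entries [expR (d_i)] and preserves the cross product, so
    [d_i + d_j = d_k] whenever [i, j, k] lie on a Fano line; the same line read in
    the order [i, k, j] gives [d_i + d_k = d_j], hence [2 d_i = 0].

    The analytic input is the matrix exponential: entrywise it is a real series
    dominated by the exponential series of a scalar
    ([cvg_series_mx_exp_coord]), so [t |-> exp (t A)] can be differentiated
    entrywise as a power series. *)

(** * The cross product in coordinates *)

(** Over [int] the structure constants compute, so that their finitely many
    properties can be checked by evaluation and then transported to any ring. *)
Lemma octonion_eps_intr (R : pzRingType) (i j k : nat) :
  octonion_eps R i j k = (octonion_eps int i j k)%:~R.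
Proof. by rewrite /octonion_eps; case: ifP => _; [|case: ifP]. Qed.

Lemma all_iota_ord (P : pred nat) (n : nat) :
  all P (iota 1 n) -> forall i : 'I_n, P i.+1.
Proof.
by move=> /allP h i; apply: h; rewrite mem_iota /= add1n ltnS ltn_ord.
Qed.

Lemma has_iota_ord (P : pred nat) (n : nat) :
  has P (iota 1 n) -> exists i : 'I_n, P i.+1.
Proof.
case/hasP => -[|k]; rewrite mem_iota //= add1n ltnS => kn Pk.
by exists (Ordinal kn).
Qed.

Lemma octonion_eps_antisym (R : pzRingType) (i j k : 'I_7) :
  octonion_eps R j.+1 i.+1 k.+1 = - octonion_eps R i.+1 j.+1 k.+1 /\
  octonion_eps R i.+1 k.+1 j.+1 = - octonion_eps R i.+1 j.+1 k.+1.
Proof.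
have table : all (fun a => all (fun b => all (fun c =>
    (octonion_eps int b a c == - octonion_eps int a b c) &&
    (octonion_eps int a c b == - octonion_eps int a b c))
    (iota 1 7)) (iota 1 7)) (iota 1 7) by vm_compute.
have /all_iota_ord/(_ j)/all_iota_ord/(_ k)/andP[/eqP e1 /eqP e2] :=
  all_iota_ord table i.
by rewrite !(octonion_eps_intr R) -!rmorphN /= e1 e2.
Qed.

(** In the Fano plane, whose lines are the triples with a nonzero structure
    constant, [k] is the third point of the line through [i] and [j]; conversely
    [j] is the only third point of the line through [i] and [k]. *)
Lemma fano_line (R : numDomainType) (i j : 'I_7) : i != j ->
  exists k : 'I_7, octonion_eps R i.+1 j.+1 k.+1 != 0 /\
    forall l : 'I_7, l != j -> octonion_eps R i.+1 l.+1 k.+1 = 0.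
Proof.
have table : all (fun a => all (fun b => (a == b) || has (fun c =>
    (octonion_eps int a b c != 0) &&
    all (fun d => (d == b) || (octonion_eps int a d c == 0)) (iota 1 7))
    (iota 1 7)) (iota 1 7)) (iota 1 7) by vm_compute.
move=> ij; have /all_iota_ord/(_ j) := all_iota_ord table i.
rewrite eqSS (negPf ij : (i == j :> nat) = false) orFb.
case/has_iota_ord => k /andP[ijk /all_iota_ord uniq_j].
exists k; split=> [|l lj]; rewrite octonion_eps_intr ?intr_eq0 //.
have := uniq_j l.
by rewrite eqSS (negPf lj : (l == j :> nat) = false) => /eqP->.
Qed.

Section Cross.
Variable R : realType.
Implicit Types (u v : 'cV[R]_7).

Lemma imaginary_mul_coord u v (k : 'I_7) :
  octonion_mul (imaginary_octonion u) (imaginary_octonion v) (lift ord0 k) 0 =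
  \sum_i \sum_j u i 0 * v j 0 * octonion_eps R i.+1 j.+1 k.+1.
Proof.
have im0 (w : 'cV[R]_7) : imaginary_octonion w ord0 0 = 0.
  rewrite /imaginary_octonion (_ : ord0 = lshift 7 (0 : 'I_1)).
    by rewrite (@col_mxEu _ 1) mxE.
  exact: val_inj.
have imS (w : 'cV[R]_7) (i : 'I_7) :
    imaginary_octonion w (lift ord0 i) 0 = w i 0.
  rewrite /imaginary_octonion (_ : lift _ _ = rshift 1 i); last exact: val_inj.
  by rewrite (@col_mxEd _ 1).
move: (im0 u) (imS u) (im0 v) (imS v).
move: (imaginary_octonion u) (imaginary_octonion v) => x y x0 xS y0 yS.
rewrite summxE big_ord_recl summxE big1 ?add0r; last first.
  by move=> j _; rewrite mxE x0 !mul0r.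
apply: eq_bigr => i _; rewrite summxE big_ord_recl [X in X + _]mxE y0 mulr0.
rewrite mul0r add0r; apply: eq_bigr => j _; rewrite mxE xS yS; congr (_ * _).
rewrite /octonion_basis_mul /= !mxE /= mulr0 add0r summxE.
rewrite (bigD1 (lift ord0 k)) //= big1 ?addr0.
  by rewrite !mxE !eqxx mulr1.
by move=> l /andP[_ lk]; rewrite !mxE [_ == l]eq_sym (negPf lk) mulr0.
Qed.

Lemma cross_coord u v (k : 'I_7) :
  cross u v k 0 = \sum_i \sum_j u i 0 * v j 0 * octonion_eps R i.+1 j.+1 k.+1.
Proof.
rewrite /cross /imaginary_part /=.
rewrite [LHS]mxE (_ : rshift 1 k = lift ord0 k); last exact: val_inj.
rewrite !mxE !imaginary_mul_coord [X in _ - X]exchange_big -sumrB mulr_sumr.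
apply: eq_bigr => i _; rewrite -sumrB mulr_sumr; apply: eq_bigr => j _.
have [-> _] := octonion_eps_antisym R i j k.
rewrite [v j 0 * _]mulrC mulrN opprK -[X in _ * X]mulr2n.
by rewrite -[X in _ * X]mulr_natl mulKf.
Qed.

Lemma cross_basis (i k : 'I_7) v :
  cross (delta_mx i 0) v k 0 = \sum_j v j 0 * octonion_eps R i.+1 j.+1 k.+1.
Proof.
rewrite cross_coord (bigD1 i) //= [X in _ + X]big1 ?addr0.
  by apply: eq_bigr => j _; rewrite mxE !eqxx mul1r.
by move=> l li; apply: big1 => j _; rewrite mxE (negPf li) !mul0r.
Qed.

Lemma cross_basis2 (i j k : 'I_7) :
  cross (delta_mx i 0) (delta_mx j 0) k 0 = octonion_eps R i.+1 j.+1 k.+1.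
Proof.
rewrite cross_basis (bigD1 j) //= [X in _ + X]big1 ?addr0.
  by rewrite mxE !eqxx mul1r.
by move=> m mj; rewrite mxE (negPf mj) mul0r.
Qed.

Lemma crossZ (a b : R) u v : cross (a *: u) (b *: v) = (a * b) *: cross u v.
Proof.
apply/colP => k; rewrite [RHS]mxE !cross_coord mulr_sumr.
apply: eq_bigr => i _; rewrite mulr_sumr; apply: eq_bigr => j _.
by rewrite [(a *: u) i 0]mxE [(b *: v) j 0]mxE mulrACA !mulrA.
Qed.

Lemma crossNN u v : cross (- u) (- v) = cross u v.
Proof. by rewrite -scaleN1r -(scaleN1r v) crossZ mulrNN mulr1 scale1r. Qed.

(** If [k] is the third point of the line through [i] and [j], then coordinate
    [k] of [e_i x v] is [v_j] up to sign. *)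
Lemma cross_basis_eq0 (i : 'I_7) v :
  cross (delta_mx i 0) v = 0 -> forall j, j != i -> v j 0 = 0.
Proof.
move=> /colP iv0 j ji; have [|k [ijk_neq0 uniq_j]] := @fano_line R i j.
  by rewrite eq_sym.
have /eqP := iv0 k; rewrite cross_basis mxE (bigD1 j) //= big1 ?addr0.
  by rewrite mulf_eq0 (negPf ijk_neq0) orbF => /eqP.
by move=> l lj; rewrite uniq_j ?mulr0.
Qed.

(** The cross product is half of the commutator of imaginary octonions, which an
    algebra automorphism preserves. *)
Lemma G2_cross g u v : G2 g -> cross (g *m u) (g *m v) = g *m cross u v.
Proof.
case=> f [_ fM] fg.
have: imaginary_octonion (cross (g *m u) (g *m v)) =
      imaginary_octonion (g *m cross u v).
  rewrite imaginary_octonion_cross -!fg imaginary_octonion_cross.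
  by rewrite [RHS]linearZ [f (_ - _)]linearB !fM.
by rewrite /imaginary_octonion => /(@eq_col_mx _ 1 7)[].
Qed.

(** Compare the coefficients of [e_k] in [g e_i x g e_j = g (e_i x e_j)] for
    [g = diag_mx d]. *)
Lemma G2_diag_eps (d : 'rV[R]_7) : G2 (diag_mx d) ->
  forall i j k : 'I_7, octonion_eps R i.+1 j.+1 k.+1 != 0 ->
  d 0 i * d 0 j = d 0 k.
Proof.
move=> gd i j k /mulIf; apply.
have /colP/(_ k) := G2_cross (delta_mx i 0) (delta_mx j 0) gd.
have gE l : diag_mx d *m delta_mx l 0 = d 0 l *: delta_mx l 0 :> 'cV[R]_7.
  apply/colP => m; rewrite mul_diag_mx !mxE; case: eqVneq => [->//|_].
  by rewrite !mulr0.
have gk (w : 'cV[R]_7) m : (diag_mx d *m w) m 0 = d 0 m * w m 0.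
  by rewrite mul_diag_mx mxE.
rewrite (gE i) (gE j) gk crossZ cross_basis2 => <-.
by rewrite [RHS]mxE cross_basis2.
Qed.
End Cross.

(** * The matrix exponential *)

Section MxExp.
Local Open Scope classical_set_scope.
Variables (R : realType) (n : nat).
Implicit Types A : 'M[R]_n.+1.

Lemma cvg_mx_coord p q (u : nat -> 'M[R]_(p, q)) (L : 'M[R]_(p, q)) :
  (forall i j, (u k i j @[k --> \oo] --> L i j)) -> u @ \oo --> L.
Proof.
move=> uL; apply/cvgrPdist_le => /= e e0; near=> k.
rewrite /Num.Def.normr /= mx_normrE bigmax_le ?ltW // => ij _.
rewrite !mxE; move: ij; near: k; apply: filter_forall => ij /=.
exact: ((cvgrPdist_le _ _).1 (uL ij.1 ij.2)).
Unshelve. all: by end_near. Qed.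

(** The sum of the absolute values of all entries is a submultiplicative norm that
    dominates each entry. *)
Lemma mx_pow_coord_le A : exists2 a : R, 0 <= a &
  forall k i j, `|(A ^+ k) i j| <= a ^+ k.
Proof.
pose a := \sum_i \sum_j `|A i j|.
have a0 : 0 <= a by apply: sumr_ge0 => i _; apply: sumr_ge0.
exists a => //; elim=> [|k IH] i j.
  rewrite expr0 -[1 in X in X <= _]/(1%:M) mxE.
  by case: (i == j); rewrite ?normr1 ?normr0.
rewrite exprS -[_ * _ in X in X <= _]/(A *m A ^+ k) mxE.
rewrite (le_trans (ler_norm_sum _ _ _)) //.
apply: (@le_trans _ _ ((\sum_l `|A i l|) * a ^+ k)).
  by rewrite mulr_suml; apply: ler_sum => l _; rewrite normrM ler_wpM2l.
rewrite exprS ler_wpM2r ?exprn_ge0 // /a [leRHS](bigD1 i) //= lerDl.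
by apply: sumr_ge0 => m _; apply: sumr_ge0.
Qed.

(** The shift by [m] covers the [m]-th formal derivative in [t] at [1] of the series
    of [exp (t A)], which termwise differentiation needs for [m <= 2]. *)
Lemma cvg_series_mx_exp_coord A (m : nat) i j :
  cvgn (series (fun k => k`!%:R^-1 * (A ^+ (k + m)) i j)).
Proof.
have [a a0 Aa] := mx_pow_coord_le A.
apply: normed_cvg.
apply: (@series_le_cvg _ _ (a ^+ m *: exp_coeff a)) => [k|k|k|].
- exact: normr_ge0.
- by rewrite mulr_ge0 ?exprn_ge0 ?exp_coeff_ge0.
- have -> : (a ^+ m *: exp_coeff a) k = k`!%:R^-1 * a ^+ (k + m).
    by rewrite exp_coeffE exprD mulrA mulrC.
  rewrite /= normrM ger0_norm ?invr_ge0 //.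
  by rewrite ler_wpM2l ?invr_ge0.
- exact/is_cvg_seriesZ/is_cvg_series_exp_coeff.
Qed.

(** [mx_exp] is the limit of a sequence of matrices, which is meaningful only if
    that sequence converges; it does because its entries do. *)
Lemma mx_exp_coord A i j :
  mx_exp A i j = limn (series (fun k => k`!%:R^-1 * (A ^+ k) i j)).
Proof.
pose L := \matrix_(i, j) limn (series (fun k => k`!%:R^-1 * (A ^+ k) i j)).
suff -> : mx_exp A = L by rewrite mxE.
apply/cvg_lim; first exact: norm_hausdorff.
apply: cvg_mx_coord => {}i {}j; rewrite mxE.
rewrite (_ : (fun k => _) = series (fun k => k`!%:R^-1 * (A ^+ k) i j)).
  by have := @cvg_series_mx_exp_coord A 0 i j; under eq_fun do rewrite addn0.
apply/funext => k; rewrite /series /= summxE.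
by apply: eq_bigr => l _; rewrite mxE.
Qed.

Lemma is_derive_mx_exp_coord A i j :
  is_derive (0 : R) (1 : R) (fun t => mx_exp (t *: A) i j) (A i j).
Proof.
pose c k : R := k`!%:R^-1 * (A ^+ k) i j.
have diffs m k : iter m (@pseries_diffs R) c k = k`!%:R^-1 * (A ^+ (k + m)) i j.
  elim: m k => [|m IH] k /=; first by rewrite addn0.
  by rewrite /pseries_diffs IH addSnnS factS natrM invfM mulrA mulVKf.
have cvg1 m : cvgn (pseries (iter m (@pseries_diffs R) c) 1).
  rewrite /pseries; under eq_fun do rewrite expr1n mulr1 diffs.
  exact: cvg_series_mx_exp_coord.
have -> : (fun t => mx_exp (t *: A) i j) = (fun t => limn (pseries c t)).
  apply/funext => t; rewrite mx_exp_coord; congr (limn (series _)).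
  by apply/funext => k; rewrite exprZn mxE /c mulrCA mulrC.
apply: is_derive_eq.
  (* Any radius of convergence larger than the norm of the point 0 would do. *)
  apply: (@pseries_snd_diffs _ c 1); [exact: (cvg1 0)|exact: (cvg1 1)| |].
    exact: (cvg1 2).
  by rewrite normr0 normr1.
(* At 0 all partial sums but the empty one equal the constant term. *)
apply/cvg_lim => //; rewrite -cvg_shiftS /pseries /=.
rewrite (_ : (fun k => _) = cst (A i j)); first exact: cvg_cst.
apply/funext => k; rewrite /series /= big_nat_recl // expr0 mulr1 big1.
  by rewrite addr0 -/(iter 1 _ c 0%N) diffs fact0 invr1 mul1r.
by move=> l _; rewrite expr0n mulr0.
Qed.

Lemma mx_exp_diag (d : 'rV[R]_n.+1) :
  mx_exp (diag_mx d) = diag_mx (map_mx expR d).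
Proof.
apply/matrixP => i j; rewrite mx_exp_coord !mxE.
have dX k : diag_mx d ^+ k = diag_mx (map_mx (fun x => x ^+ k) d).
  elim: k => [|k IH]; apply/matrixP => p q.
    by rewrite expr0 -[1]/(1%:M) !mxE.
  rewrite exprS IH -[_ * _]/(_ *m _) mul_diag_mx !mxE exprS.
  by case: eqVneq => [->|_]; rewrite ?mulr1n ?mulr0n ?mulr0.
under [X in series X]eq_fun do rewrite dX !mxE.
case: eqVneq => [->|_].
  by congr (limn (series _)); apply/funext => k; rewrite exp_coeffE.
apply/cvg_lim => //; rewrite (_ : series _ = cst 0); first exact: cvg_cst.
by apply/funext => k; rewrite /series /= big1 // => l _; rewrite mulr0n mulr0.
Qed.
End MxExp.

Lemma fundamental_fieldE (R : realType) (xi : 'M[R]_7) p :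
  fundamental_field xi p = xi *m p.
Proof.
have D i : is_derive (0 : R) (1 : R) (fun t => (mx_exp (t *: xi) *m p) i 0)
    ((xi *m p) i 0).
  rewrite mxE (_ : (fun t => _) =
      \sum_(j < 7) (p j 0 \*: (fun t : R => mx_exp (t *: xi) i j))).
    have -> : \sum_j xi i j * p j 0 = \sum_(j < 7) p j 0 *: xi i j.
      by apply: eq_bigr => j _; rewrite [RHS]mulrC.
    apply: is_derive_sum => j; apply: is_deriveZ.
    exact: is_derive_mx_exp_coord.
  apply/funext => t; rewrite mxE fct_sumE.
  by apply: eq_bigr => j _; rewrite [RHS]mulrC.
rewrite /fundamental_field derive1E derive_mx; last first.
  by apply/derivable_mxP => i j; rewrite ord1; exact: ex_derive.
apply/colP => i; rewrite mxE; exact: derive_val.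
Qed.

(** * Diagonal elements of the Lie algebra, and the theorem *)

Section Diagonal.
Variable R : realType.

(** The diagonal of such a matrix is additive along Fano lines, in every order of
    the three points. *)
Lemma g2_diag_eq0 (d : 'rV[R]_7) : g2 (diag_mx d) -> d = 0.
Proof.
move=> /(_ 1); rewrite scale1r mx_exp_diag => gd.
have add_d (i j k : 'I_7) : octonion_eps R i.+1 j.+1 k.+1 != 0 ->
    d 0 i + d 0 j = d 0 k.
  by move=> /(G2_diag_eps gd); rewrite !mxE -expRD => /expR_inj.
apply/rowP => i; rewrite mxE.
have [j ij] : exists j, i != j.
  by have [->|i0] := eqVneq i ord0; [exists ord_max | exists ord0].
have [k [ijk _]] := @fano_line R _ _ ij.
have ikj : octonion_eps R i.+1 k.+1 j.+1 != 0.
  by have [_ ->] := octonion_eps_antisym R i j k; rewrite oppr_eq0.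
have /eqP := add_d _ _ _ ikj; rewrite -(add_d _ _ _ ijk) addrA.
by rewrite -subr_eq0 addrK -mulr2n mulrn_eq0 /= => /eqP.
Qed.

Lemma S6_basis (i : 'I_7) : S6 (delta_mx i 0 : 'cV[R]_7).
Proof.
rewrite /S6 /= (bigD1 i) //= big1 ?addr0; first by rewrite mxE !eqxx expr1n.
by move=> j ji; rewrite mxE (negPf ji) expr0n.
Qed.

Lemma S6N (p : 'cV[R]_7) : S6 p -> S6 (- p).
Proof.
by rewrite /S6 /= => <-; apply: eq_bigr => i _; rewrite mxE sqrrN.
Qed.
End Diagonal.

Theorem proposition3p12 (R : realType) (xi : 'M[R]_7) (xi_g2 : g2 xi)
    (xi_neq0 : xi <> 0) :
  ~ is_fundamental_field (J_field (fundamental_field xi)).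
Proof.
case=> eta _ Jxi; apply: xi_neq0.
have {}Jxi p : S6 p -> cross p (xi *m p) = eta *m p.
  by move=> /Jxi; rewrite /J_field /J !fundamental_fieldE.
(* Compare [Jxi] at [p] and at [- p]: its left-hand side is even, its
   right-hand side odd. *)
have cross0 p : S6 p -> cross p (xi *m p) = 0.
  move=> Sp; have := Jxi _ (S6N Sp).
  rewrite !mulmxN crossNN Jxi // => /eqP.
  rewrite -addr_eq0 -mulr2n -scaler_nat scaler_eq0 pnatr_eq0 /=.
  by move=> /eqP.
have xi_offdiag i j : j != i -> xi j i = 0.
  move=> ji; have /cross_basis_eq0/(_ _ ji) := cross0 _ (S6_basis R i).
  by rewrite -colE mxE.
have xiE : xi = diag_mx (\row_i xi i i).
  apply/matrixP => i j; rewrite !mxE; case: eqVneq => [->//|ij].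
  by rewrite mulr0n xi_offdiag.
move: xi_g2; rewrite xiE => /g2_diag_eq0->.
by apply/matrixP => i j; rewrite !mxE mul0rn.
Qed.
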